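(* Let $0\le\delta\le\epsilon<1$, let $F\in M_n(\mathbb{C})$ be a $\delta$-near-symmetric rank-$k$ matrix, and let $X\in\mathbb{C}^{n\times s}$ be a test matrix with $s\ge k$ orthonormal columns such that $\operatorname{rank}(FX)=k$. Let $F=U_0\Sigma_0V_0^*$ be a slim SVD of $F$ and let $c=\sigma_{\max}(X^*V_0)/\sigma_{\min}(X^*V_0)^2$. If $c\big(\sqrt{2\epsilon}+\sqrt{2\delta}\big)<1$, then $$\sup_{A,B\in\Omega_{F,X}^{\epsilon}}\|A-B\|_2\le 4\|FX\|_2\left[\frac{c^2\big(\sqrt{2\epsilon}+\sqrt{2\delta}\big)}{1-c\big(\sqrt{2\epsilon}+\sqrt{2\delta}\big)}\right].$$
   Context: $\|\cdot\|_2$ is the spectral norm; $\sigma_{\max}$ and $\sigma_{\min}$ denote the largest and the smallest nonzero singular values of a matrix. For a rank-$k$ matrix $A\in M_n(\mathbb{C})$ (with $k\ge 1$), a slim SVD is $A=U_AS_AV_A^*$ with $U_A,V_A\in\mathbb{C}^{n\times k}$ having orthonormal columns and $S_A\in\mathbb{R}^{k\times k}$ diagonal with positive entries. A rank-$k$ matrix $F\in M_n(\mathbb{C})$ with slim SVD $F=U_FS_FV_F^*$ is called $\delta$-near-symmetric if there is a $k\times k$ unitary matrix $Q$ with $\|U_F^*V_F-Q\|_2\le\delta$. For a rank-$k$ matrix $F$ and $X\in\mathbb{C}^{n\times s}$, $$\Omega_{F,X}^{\epsilon}=\{A\in M_n(\mathbb{C}):\ \operatorname{rank}(A)=k,\ AX=FX,\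 \exists\, Q\in\mathbb{C}^{k\times k}\text{ unitary with }\|U_A^*V_A-Q\|_2\le\epsilon\},$$ where $A=U_AS_AV_A^*$ is a slim SVD of $A$. *)

(* Defs.v *)
(* The field of complex numbers is R[i] for R : realType. *)
From HB Require Import structures.
From mathcomp Require Import all_boot all_order all_algebra.
From mathcomp Require Import boolp classical_sets reals constructive_ereal ereal.
From mathcomp Require Import complex.

Set Implicit Arguments.
Unset Strict Implicit.
Unset Printing Implicit Defensive.

Import Order.TTheory GRing.Theory Num.Theory.
Local Open Scope classical_set_scope.
Local Open Scope ring_scope.
Local Open Scope complex_scope.
Local Open Scope sesquilinear_scope.

(* Nonnegative square roots of the eigenvalues of the Gram matrix A^* A.  When A
   has more columns than rows, this set contains 0 in addition to the usual
   min(m, n) singular values; neither sigma_max nor sigma_min is affected. *)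
Definition singular_values (R : realType) (m n : nat) (A : 'M[R[i]]_(m, n)) :
    set R :=
  [set s | 0 <= s /\ eigenvalue (A ^t* *m A) (s ^+ 2)%:C].

(* The set of singular values is finite, so sup and inf are a maximum and a
   minimum as soon as the set is nonempty; both are 0 on the empty set. *)
Definition sigma_max (R : realType) (m n : nat) (A : 'M[R[i]]_(m, n)) : R :=
  sup (singular_values A).

Definition sigma_min (R : realType) (m n : nat) (A : 'M[R[i]]_(m, n)) : R :=
  inf [set s | singular_values A s /\ 0 < s].

Definition spectral_norm (R : realType) (m n : nat) (A : 'M[R[i]]_(m, n)) : R :=
  sigma_max A.

(* unitarymx would ask for orthonormal rows. *)
Definition orthonormal_cols (R : realType) (m n : nat) (A : 'M[R[i]]_(m, n)) :=
  A ^t* *m A = 1%:M.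

Definition slim_svd (R : realType) (n k : nat) (A : 'M[R[i]]_n)
    (U : 'M[R[i]]_(n, k)) (S : 'M[R]_k) (V : 'M[R[i]]_(n, k)) : Prop :=
  [/\ orthonormal_cols U, orthonormal_cols V,
      is_diag_mx S, (forall i : 'I_k, 0 < S i i)
    & A = U *m map_mx (real_complex R) S *m V ^t*].

(* Two slim SVDs of the same matrix differ by (U, V) |-> (U W, V W) with W
   unitary, so the condition on U^* V does not depend on the chosen SVD. *)
Definition near_symmetric (R : realType) (n k : nat) (delta : R)
    (F : 'M[R[i]]_n) : Prop :=
  \rank F = k /\
  exists (U : 'M[R[i]]_(n, k)) (S : 'M[R]_k) (V : 'M[R[i]]_(n, k)),
    slim_svd F U S V /\
    exists Q : 'M[R[i]]_k,
      Q \is unitarymx /\ spectral_norm (U ^t* *m V - Q) <= delta.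

Definition Omega (R : realType) (n s k : nat) (F : 'M[R[i]]_n)
    (X : 'M[R[i]]_(n, s)) (epsilon : R) : set 'M[R[i]]_n :=
  [set A | near_symmetric k epsilon A /\ A *m X = F *m X].

(* Main.v *)
(* Replacing the slim SVD A = U S V^* by A = U M Y^* with Y = V Q^* puts the right
   frame Y within sqrt (2 epsilon) of the left one, since
   (Y - U)^* (Y - U) = 2 - Y^* U - U^* Y.  As A X = F X has rank k, all A in Omega
   share the column space of F, so the same U serves for A and F; their right
   frames are then within eta = sqrt (2 epsilon) + sqrt (2 delta) of each other,
   and A X = F X determines M up to an error controlled by eta / sigma_min.
   Finally A and B are compared through F. *)
Require Import Defs.
From HB Require Import structures.
From mathcomp Require Import all_boot all_order all_algebra.
From mathcomp Require Import boolp classical_sets reals constructive_ereal ereal.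
From mathcomp Require Import complex.
From mathcomp Require Import ring.

Set Implicit Arguments.
Unset Strict Implicit.
Unset Printing Implicit Defensive.

Import Order.TTheory GRing.Theory Num.Theory.
Local Open Scope classical_set_scope.
Local Open Scope ring_scope.
Local Open Scope complex_scope.
Local Open Scope sesquilinear_scope.

(** * Adjoints and the Euclidean norm of row vectors *)

Lemma adjmxM (C : numClosedFieldType) (m n p : nat) (A : 'M[C]_(m, n))
    (B : 'M[C]_(n, p)) : (A *m B)^t* = B^t* *m A^t*.
Proof. by rewrite trmx_mul map_mxM. Qed.

Lemma adjmxB (C : numClosedFieldType) (m n : nat) (A B : 'M[C]_(m, n)) :
  (A - B)^t* = A^t* - B^t*.
Proof. by rewrite linearB map_mxB. Qed.

Lemma adjmx1 (C : numClosedFieldType) (n : nat) : (1%:M : 'M[C]_n)^t* = 1%:M.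
Proof. by rewrite trmx1 map_mx1. Qed.

Lemma sqrtC_dotmxD (C : numClosedFieldType) (n : nat) (u v : 'rV[C]_n) :
  sqrtC (dotmx (u + v) (u + v)) <= sqrtC (dotmx u u) + sqrtC (dotmx v v).
Proof. exact: (triangle_lerif (@dotmx C n) u v).1. Qed.

Lemma norm_dotmx_le (C : numClosedFieldType) (n : nat) (u v : 'rV[C]_n) :
  `|dotmx u v| <= sqrtC (dotmx u u) * sqrtC (dotmx v v).
Proof. exact: (CauchySchwarz_sqrt (@dotmx C n) u v).1. Qed.

(** Real-valued, so that it compares with the bounds in [R]; [sqrtC] lands in [R[i]], but here on a
    nonnegative real, so the real part loses nothing. *)
HB.lock Definition vnorm (R : realType) (n : nat) (v : 'rV[R[i]]_n) : R :=
  complex.Re (sqrtC (dotmx v v)).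

Lemma vnormE (R : realType) (n : nat) (v : 'rV[R[i]]_n) :
  (vnorm v)%:C = sqrtC (dotmx v v).
Proof. by rewrite unlock RRe_real// ger0_real// sqrtC_ge0 dnorm_ge0. Qed.

Lemma vnorm_ge0 (R : realType) (n : nat) (v : 'rV[R[i]]_n) : 0 <= vnorm v.
Proof. by rewrite -ler0c vnormE sqrtC_ge0 dnorm_ge0. Qed.

Lemma vnorm_sqr (R : realType) (n : nat) (v : 'rV[R[i]]_n) :
  (vnorm v ^+ 2)%:C = (v *m v^t*) 0 0.
Proof. by rewrite rmorphXn /= vnormE sqrtCK dotmxE. Qed.

Lemma vnorm_gt0 (R : realType) (n : nat) (v : 'rV[R[i]]_n) :
  (0 < vnorm v) = (v != 0).
Proof. by rewrite -ltcR vnormE sqrtC_gt0 dnorm_gt0. Qed.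

Lemma vnorm_eq0 (R : realType) (n : nat) (v : 'rV[R[i]]_n) :
  (vnorm v == 0) = (v == 0).
Proof. by apply: negb_inj; rewrite -vnorm_gt0 lt0r vnorm_ge0 andbT. Qed.

(** The widths may differ, which covers isometries into another dimension. *)
Lemma eq_vnorm (R : realType) (m n : nat) (u : 'rV[R[i]]_m) (v : 'rV[R[i]]_n) :
  u *m u^t* = v *m v^t* -> vnorm u = vnorm v.
Proof.
move=> uv; apply/eqP; rewrite -(@eqrXn2 _ 2) ?vnorm_ge0//; apply/eqP.
by apply: complexI; rewrite !vnorm_sqr uv.
Qed.

Lemma ler_vnormD (R : realType) (n : nat) (u v : 'rV[R[i]]_n) :
  vnorm (u + v) <= vnorm u + vnorm v.
Proof.
rewrite -lecR rmorphD /= (vnormE (u + v)) (vnormE u) (vnormE v).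
exact: sqrtC_dotmxD.
Qed.

Lemma vnormN (R : realType) (n : nat) (v : 'rV[R[i]]_n) :
  vnorm (- v) = vnorm v.
Proof. by apply: eq_vnorm; rewrite linearN map_mxN mulNmx mulmxN opprK. Qed.

Lemma ler_vnormB (R : realType) (n : nat) (u v : 'rV[R[i]]_n) :
  vnorm (u - v) <= vnorm u + vnorm v.
Proof. by rewrite -(vnormN v) ler_vnormD. Qed.

Lemma Re_dotmx_le (R : realType) (n : nat) (u v : 'rV[R[i]]_n) :
  complex.Re ((u *m v^t*) 0 0) <= vnorm u * vnorm v.
Proof.
rewrite -dotmxE -lecR rmorphM /= (vnormE u) (vnormE v).
apply: le_trans (norm_dotmx_le u v).
apply: le_trans (normc_ge_Re _); rewrite lecR; exact: ler_norm.
Qed.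

(** * Operator bounds and their calculus *)

(* r bounds the operator norm of v |-> v A on row vectors, hence, by
   mx_bound_adj, also that of x |-> A x on columns; spectral_norm A turns out to
   be the least such bound. *)
Definition mx_bound (R : realType) (m n : nat) (A : 'M[R[i]]_(m, n)) (r : R) :=
  0 <= r /\ forall v : 'rV_m, vnorm (v *m A) <= r * vnorm v.

Lemma mx_boundM (R : realType) (m n p : nat) (A : 'M[R[i]]_(m, n))
    (B : 'M[R[i]]_(n, p)) (a b : R) :
  mx_bound A a -> mx_bound B b -> mx_bound (A *m B) (a * b).
Proof.
move=> [a0 Aa] [b0 Bb]; split=> [|v]; first exact: mulr_ge0.
rewrite mulmxA (le_trans (Bb _))// [a * b]mulrC -mulrA ler_wpM2l//.
Qed.

Lemma mx_boundD (R : realType) (m n : nat) (A B : 'M[R[i]]_(m, n)) (a b : R) :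
  mx_bound A a -> mx_bound B b -> mx_bound (A + B) (a + b).
Proof.
move=> [a0 Aa] [b0 Bb]; split=> [|v]; first exact: addr_ge0.
by rewrite mulmxDr mulrDl (le_trans (ler_vnormD _ _))// lerD.
Qed.

Lemma mx_boundB (R : realType) (m n : nat) (A B : 'M[R[i]]_(m, n)) (a b : R) :
  mx_bound A a -> mx_bound B b -> mx_bound (A - B) (a + b).
Proof.
move=> [a0 Aa] [b0 Bb]; split=> [|v]; first exact: addr_ge0.
by rewrite mulmxBr mulrDl (le_trans (ler_vnormB _ _))// lerD.
Qed.

(** [|v A^*|^2] is the inner product of [v A^* A] with [v], at most [a |v A^*| |v|] by
    Cauchy-Schwarz; then [|v A^*|] cancels. *)
Lemma mx_bound_adj (R : realType) (m n : nat) (A : 'M[R[i]]_(m, n)) (a : R) :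
  mx_bound A a -> mx_bound (A^t*) a.
Proof.
move=> [a0 Aa]; split=> // v; have [->|vA0] := eqVneq (v *m A^t*) 0.
  by have /eqP -> : vnorm (0 : 'rV[R[i]]_m) == 0;
    rewrite ?vnorm_eq0 ?mulr_ge0 ?vnorm_ge0.
rewrite -(ler_pM2l (x := vnorm (v *m A^t*))) ?vnorm_gt0// -expr2.
have -> : vnorm (v *m A^t*) ^+ 2 = complex.Re ((v *m A^t* *m A *m v^t*) 0 0).
  suff <- : (vnorm (v *m A^t*) ^+ 2)%:C = (v *m A^t* *m A *m v^t*) 0 0 by [].
  by rewrite vnorm_sqr adjmxM trmxCK !mulmxA.
apply: le_trans (Re_dotmx_le _ _) _; rewrite mulrA ler_wpM2r ?vnorm_ge0//.
by rewrite [_ * a]mulrC.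
Qed.

Lemma mx_bound_isometry (R : realType) (m n : nat) (A : 'M[R[i]]_(m, n)) :
  A *m A^t* = 1%:M -> mx_bound A 1.
Proof.
move=> AA; split=> // v; rewrite mul1r (@eq_vnorm _ _ _ _ v)//.
by rewrite adjmxM mulmxA -(mulmxA v) AA mulmx1.
Qed.

(** * Singular values through the spectral theorem *)

(** A unitary [Q] diagonalizes [A^* A]: [d] lists the eigenvalues and [w] the squared moduli of the
    coordinates of [v Q^*]. Estimates of [|v A^*|] become termwise comparisons of weighted sums. *)
Lemma gram_spectral (R : realType) (m n : nat) (A : 'M[R[i]]_(m, n)) :
  exists d : 'I_n -> R, [/\ forall i, 0 <= d i,
    forall s, singular_values A s <-> exists i, s = Num.sqrt (d i) &
    forall v, exists w : 'I_n -> R, [/\ forall i, 0 <= w i,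
      vnorm v ^+ 2 = \sum_i w i &
      vnorm (v *m A^t*) ^+ 2 = \sum_i d i * w i]].
Proof.
have Gherm : A^t* *m A \is hermsymmx.
  by apply/is_hermitianmxP; rewrite expr0 scale1r adjmxM trmxCK.
set Q := spectralmx (A^t* *m A).
have Qu : Q \is unitarymx by exact: spectral_unitarymx.
have QQ : Q *m Q^t* = 1%:M by apply/unitarymxP.
have QQ' : Q^t* *m Q = 1%:M by apply: mulmx1C.
have /orthomx_spectralP /= := hermitian_normalmx Gherm.
rewrite -/Q invmx_unitary//; set sp := spectral_diag _ => GE.
have QG : Q *m (A^t* *m A) *m Q^t* = diag_mx sp.
  by rewrite GE !mulmxA QQ mul1mx -mulmxA QQ mulmx1.
(* The entries of [sp] are complex a priori; being squared norms, they are real and nonnegative. *)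
have spE i : sp 0 i = (vnorm (row i Q *m A^t*) ^+ 2)%:C.
  rewrite vnorm_sqr adjmxM trmxCK mulmxA -(mulmxA _ _ A) -row_mul.
  have /matrixP/(_ i i) := QG; rewrite !mxE eqxx mulr1n => <-.
  by apply: eq_bigr => j _; rewrite !mxE.
pose d i := vnorm (row i Q *m A^t*) ^+ 2.
exists d; split=> [i|s|v]; first exact: sqr_ge0.
- split.
    move=> [s0 /eigenvalueP[v vG v0]].
    have w0 : v *m Q^t* != 0.
      apply: contra_neq v0 => vQ; by rewrite -[v]mulmx1 -QQ' mulmxA vQ mul0mx.
    have /rV0Pn[i wi] := w0; exists i.
    (* At the index [i] of a nonzero coordinate, this forces [sp 0 i = s ^+ 2]. *)
    have : v *m Q^t* *m diag_mx sp = (s ^+ 2)%:C *: (v *m Q^t*).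
      rewrite -QG !mulmxA -(mulmxA _ _ Q) QQ' mulmx1 -(mulmxA v) vG.
      by rewrite scalemxAl.
    move/rowP/(_ i); rewrite mul_mx_diag !mxE => /eqP.
    rewrite mulrC -subr_eq0 -mulrBl mulf_eq0 => /orP[|/eqP h].
      rewrite subr_eq0 spE => /eqP/complexI dE.
      by rewrite /d dE sqrtr_sqr ger0_norm.
    by move: wi; rewrite mxE h eqxx.
  move=> [i ->]; split; first exact: sqrtr_ge0.
  apply/eigenvalueP; exists (row i Q); last first.
    apply/eqP => Qi0; have /matrixP/(_ i i) := QQ.
    rewrite !mxE eqxx => /eqP; rewrite big1 ?(eq_sym 0) ?oner_eq0// => j _.
    by have /rowP/(_ j) := Qi0; rewrite !mxE => ->; rewrite mul0r.
  rewrite sqr_sqrtr ?sqr_ge0// -row_mul GE !mulmxA QQ mul1mx.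
  by rewrite row_mul row_diag_mx -scalemxAl -rowE spE.
- pose w i := complex.Re (`|(v *m Q^t*) 0 i| ^+ 2).
  have wE i : (w i)%:C = `|(v *m Q^t*) 0 i| ^+ 2.
    by rewrite RRe_real// rpredX// normr_real.
  exists w; split=> [i||].
  + by rewrite -ler0c wE exprn_ge0.
  + apply: complexI; rewrite rmorph_sum /= vnorm_sqr.
    have -> : v *m v^t* = (v *m Q^t*) *m (v *m Q^t*)^t*.
      by rewrite adjmxM trmxCK mulmxA -(mulmxA v) QQ' mulmx1.
    by rewrite mxE; apply: eq_bigr => i _; rewrite wE !mxE normCK.
  + apply: complexI; rewrite rmorph_sum /= vnorm_sqr.
    have -> : (v *m A^t*) *m (v *m A^t*)^t* =
        (v *m Q^t*) *m diag_mx sp *m (v *m Q^t*)^t*.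
      by rewrite !adjmxM !trmxCK !mulmxA -[in LHS](mulmxA _ _ A) GE !mulmxA.
    rewrite mul_mx_diag mxE; apply: eq_bigr => i _.
    by rewrite rmorphM /= wE -spE normCK !mxE mulrAC mulrC.
Qed.

Lemma singular_value_attained (R : realType) (m n : nat) (A : 'M[R[i]]_(m, n))
    (s : R) :
  singular_values A s ->
  exists2 v : 'rV_n, v != 0 & vnorm (v *m A^t*) = s * vnorm v.
Proof.
move=> [s0 /eigenvalueP[v vG v0]]; exists v => //.
apply/eqP; rewrite -(@eqrXn2 _ 2) ?mulr_ge0 ?vnorm_ge0//; apply/eqP.
apply: complexI; rewrite exprMn [RHS]rmorphM /= !vnorm_sqr adjmxM trmxCK.
by rewrite mulmxA -(mulmxA v) vG -scalemxAl mxE.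
Qed.

Lemma singular_values_ubound (R : realType) (m n : nat)
    (A : 'M[R[i]]_(m, n)) : has_ubound (singular_values A).
Proof.
have [d [d0 sv _]] := gram_spectral A.
exists (\sum_i Num.sqrt (d i)) => s /sv[i ->].
by rewrite (bigD1 i)//= lerDl sumr_ge0// => j _; rewrite sqrtr_ge0.
Qed.

Lemma spectral_norm_ge0 (R : realType) (m n : nat) (A : 'M[R[i]]_(m, n)) :
  0 <= spectral_norm A.
Proof.
(* The set is empty only for [n = 0], and [sup] is then 0. *)
have [[s As]|A0] := pselect (singular_values A !=set0); last first.
  by rewrite /spectral_norm /sigma_max sup_out// => -[].
exact: le_trans As.1 (ub_le_sup (singular_values_ubound A) As).
Qed.

(** Each [d i] is at most the square of the supremum, and so is their average with weights [w]. The
    argument bounds [A^*], the side that [gram_spectral] describes. *)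
Lemma mx_bound_spectral_norm (R : realType) (m n : nat)
    (A : 'M[R[i]]_(m, n)) : mx_bound A (spectral_norm A).
Proof.
rewrite -[A]trmxCK; apply: mx_bound_adj; rewrite trmxCK.
split=> [|v]; first exact: spectral_norm_ge0.
have [d [d0 sv /(_ v)[w [w0 vE vAE]]]] := gram_spectral A.
have A0 := spectral_norm_ge0 A.
rewrite -(@ler_pXn2r _ 2) ?nnegrE ?mulr_ge0 ?vnorm_ge0//.
rewrite exprMn vE vAE mulr_sumr ler_sum// => i _; rewrite ler_wpM2r//.
rewrite -[d i]sqr_sqrtr// ler_pXn2r ?nnegrE ?sqrtr_ge0//.
by apply: (ub_le_sup (singular_values_ubound A)); apply/sv; exists i.
Qed.

(** Every singular value is the stretching factor of [A^*] on some nonzero vector, so any bound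
    dominates it. *)
Lemma spectral_norm_le (R : realType) (m n : nat) (A : 'M[R[i]]_(m, n))
    (r : R) : mx_bound A r -> spectral_norm A <= r.
Proof.
move=> /mx_bound_adj[r0 Ar].
have [A0|A0] := pselect (singular_values A !=set0); last first.
  by rewrite /spectral_norm /sigma_max sup_out// => -[].
apply: ge_sup => // s /singular_value_attained[v v0 vA].
by rewrite -(ler_pM2r (x := vnorm v)) ?vnorm_gt0// -vA.
Qed.

(** [sigma_min] skips zero singular values; injectivity excludes them, so it bounds all [d i] from
    below. *)
Lemma sigma_min_lower_bound (R : realType) (m n : nat) (A : 'M[R[i]]_(m, n)) :
  (0 < n)%N -> (forall v : 'rV_n, v *m A^t* = 0 -> v = 0) ->
  [/\ 0 < sigma_min A, sigma_min A <= sigma_max A &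
      forall v : 'rV_n, sigma_min A * vnorm v <= vnorm (v *m A^t*)].
Proof.
case: n A => // n A _ Ainj.
have [d [d0 sv vE]] := gram_spectral A.
have svd i : singular_values A (Num.sqrt (d i)) by apply/sv; exists i.
have dgt0 i : 0 < Num.sqrt (d i).
  have [v v0 vA] := singular_value_attained (svd i).
  rewrite lt0r sqrtr_ge0 andbT; apply: contra_neq v0 => di0.
  by apply/Ainj/eqP; rewrite -vnorm_eq0 vA di0 mul0r.
have lbd : has_lbound [set s | singular_values A s /\ 0 < s].
  by exists 0 => s [_ /ltW].
have ltd i : sigma_min A <= Num.sqrt (d i) by apply: ge_inf.
have smin0 : 0 < sigma_min A.
  (* An infimum of positive numbers could be 0; a minimum over finitely many indices is not. *)
  have [i0 _ i0min] :=
    @arg_minP _ _ _ ord0 xpredT (fun i => Num.sqrt (d i)) isT.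
  apply: lt_le_trans (dgt0 i0) _; apply: lb_le_inf.
    by exists (Num.sqrt (d ord0)).
  by move=> s [/sv[i ->] _]; apply: i0min.
split=> //.
  apply: le_trans (ltd ord0) _.
  exact: (ub_le_sup (singular_values_ubound A)).
move=> v; have [w [w0 vnE vAE]] := vE v.
rewrite -(@ler_pXn2r _ 2) ?nnegrE ?mulr_ge0 ?vnorm_ge0 ?(ltW smin0)//.
rewrite exprMn vnE vAE mulr_sumr ler_sum// => i _; rewrite ler_wpM2r//.
by rewrite -[d i]sqr_sqrtr// ler_pXn2r ?nnegrE ?sqrtr_ge0 ?(ltW smin0)//.
Qed.

(** * Rank arguments and factorizations with nearby frames *)

Lemma mx_bound_le (R : realType) (m n : nat) (A : 'M[R[i]]_(m, n)) (a b : R) :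
  a <= b -> mx_bound A a -> mx_bound A b.
Proof.
move=> ab [a0 Aa]; split=> [|v]; first exact: le_trans ab.
by rewrite (le_trans (Aa v))// ler_wpM2r ?vnorm_ge0.
Qed.

Lemma mx_boundN (R : realType) (m n : nat) (A : 'M[R[i]]_(m, n)) (a : R) :
  mx_bound A a -> mx_bound (- A) a.
Proof. by move=> [a0 Aa]; split=> // v; rewrite mulmxN vnormN. Qed.

Lemma row_free_rankM (K : fieldType) (m n p : nat) (A : 'M[K]_(m, n))
    (B : 'M[K]_(n, p)) : \rank (A *m B) = n -> row_free B.
Proof.
move=> rAB; rewrite /row_free eqn_leq rank_leq_row -[X in (X <= _)%N]rAB.
exact: mxrankM_maxr.
Qed.

Lemma unitmx_rankM (K : fieldType) (m n p : nat) (A : 'M[K]_(m, n))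
    (M : 'M[K]_n) (B : 'M[K]_(n, p)) : \rank (A *m M *m B) = n -> M \in unitmx.
Proof.
move=> rF; rewrite -row_free_unit (@row_free_rankM _ _ _ _ A)//.
by apply/eqP; rewrite eqn_leq rank_leq_col -[X in (X <= _)%N]rF mxrankM_maxl.
Qed.

(** [M] need not be diagonal, so this form, unlike an SVD, survives a unitary change of the left
    frame. *)
Definition near_factor (R : realType) (n k : nat) (U : 'M[R[i]]_(n, k))
    (eta : R) (A : 'M[R[i]]_n) : Prop :=
  exists (M : 'M[R[i]]_k) (Y : 'M[R[i]]_(n, k)),
    [/\ orthonormal_cols Y, A = U *m M *m Y^t* & mx_bound ((Y - U)^t*) eta].

(** With [Y = V Q^*] and [Z = 1 - U^* Y], orthonormality gives [(Y - U)^* (Y - U) = Z + Z^*], where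
    [Z = - (U^* V - Q) Q^*] and its adjoint are both bounded by [e]. *)
Lemma mx_bound_frame (R : realType) (n k : nat) (e : R)
    (U V : 'M[R[i]]_(n, k)) (Q : 'M[R[i]]_k) :
  orthonormal_cols U -> orthonormal_cols V -> Q \is unitarymx ->
  spectral_norm (U^t* *m V - Q) <= e ->
  mx_bound ((V *m Q^t* - U)^t*) (Num.sqrt (2 * e)).
Proof.
move=> UU VV /unitarymxP QQ UVe; have QQ' := mulmx1C QQ.
set Y := V *m Q^t*; pose Z := 1%:M - U^t* *m Y.
have YY : Y^t* *m Y = 1%:M.
  by rewrite /Y adjmxM trmxCK mulmxA -(mulmxA Q) VV mulmx1.
have Ze : mx_bound Z e.
  have -> : Z = - ((U^t* *m V - Q) *m Q^t*).
    by rewrite mulmxBl QQ opprB -mulmxA.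
  rewrite -[e]mulr1; apply/mx_boundN/mx_boundM; last first.
    by apply: mx_bound_isometry; rewrite trmxCK.
  exact: mx_bound_le UVe (mx_bound_spectral_norm _).
clearbody Y; have [e0 Zv] := Ze; have [_ Zv'] := mx_bound_adj Ze.
split=> [|v]; first exact: sqrtr_ge0.
rewrite -(@ler_pXn2r _ 2) ?nnegrE ?mulr_ge0 ?sqrtr_ge0 ?vnorm_ge0//.
rewrite exprMn sqr_sqrtr ?mulr_ge0//.
have -> : vnorm (v *m (Y - U)^t*) ^+ 2 =
    complex.Re ((v *m Z *m v^t*) 0 0) + complex.Re ((v *m Z^t* *m v^t*) 0 0).
  suff /(congr1 (@complex.Re R)) /= -> : (vnorm (v *m (Y - U)^t*) ^+ 2)%:C =
      (v *m Z *m v^t*) 0 0 + (v *m Z^t* *m v^t*) 0 0.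
    by rewrite [LHS]raddfD.
  rewrite vnorm_sqr adjmxM trmxCK !mulmxA.
  have -> : v *m (Y - U)^t* *m (Y - U) = v *m Z + v *m Z^t*.
    rewrite -mulmxA -mulmxDr; congr (_ *m _).
    rewrite /Z !adjmxB adjmx1 adjmxM trmxCK mulmxBl !mulmxBr YY UU.
    by rewrite opprB addrC.
  by rewrite mulmxDl mxE.
have vv := vnorm_ge0 v.
have le1 := le_trans (Re_dotmx_le (v *m Z) v) (ler_wpM2r vv (Zv v)).
have le2 := le_trans (Re_dotmx_le (v *m Z^t*) v) (ler_wpM2r vv (Zv' v)).
apply: le_trans (lerD le1 le2) _.
have -> : 2 * e * vnorm v ^+ 2 =
  e * vnorm v * vnorm v + e * vnorm v * vnorm v by ring.
exact: lexx.
Qed.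

Lemma near_symmetric_factor (R : realType) (n k : nat) (e : R)
    (A : 'M[R[i]]_n) :
  near_symmetric k e A ->
  exists2 U : 'M[R[i]]_(n, k), orthonormal_cols U &
    near_factor U (Num.sqrt (2 * e)) A.
Proof.
move=> [rA [U [S [V [[UU VV _ _ AE] [Q [Qu UVQ]]]]]]].
exists U => //; exists (map_mx (real_complex R) S *m Q^t*), (V *m Q^t*).
have /unitarymxP QQ := Qu; have QQ' := mulmx1C QQ.
split; last exact: mx_bound_frame.
  by rewrite /orthonormal_cols adjmxM trmxCK mulmxA -(mulmxA Q) VV mulmx1.
by rewrite adjmxM trmxCK !mulmxA -(mulmxA _ _ Q) QQ' mulmx1 -AE.
Qed.

(** * Distance from [A] to [F] *)

(* A X = F X has rank k, so A and F have the same column space. *)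
Lemma near_factor_transfer (R : realType) (n s k : nat) (e : R)
    (A F : 'M[R[i]]_n) (X : 'M[R[i]]_(n, s)) (U U1 : 'M[R[i]]_(n, k))
    (C : 'M[R[i]]_(k, n)) :
  orthonormal_cols U -> orthonormal_cols U1 -> F = U1 *m C ->
  A *m X = F *m X -> \rank (F *m X) = k ->
  near_factor U e A -> near_factor U1 e A.
Proof.
move=> UU U11 FE AXFX rFX [M [Y [YY AE Ye]]].
have UC : U *m (M *m Y^t* *m X) = U1 *m (C *m X).
  by rewrite !mulmxA -FE -AE.
have free : row_free (M *m Y^t* *m X).
  by apply: (@row_free_rankM _ _ _ _ U); rewrite !mulmxA -AE AXFX.
(* The free factor has a right inverse, so the columns of [U] lie in the span of those of [U1],
   where [U1 U1^*] acts as the identity. *)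
pose W := U1^t* *m U.
have UW : U1 *m W = U.
  have UE : U = U1 *m (C *m X *m pinvmx (M *m Y^t* *m X)).
    by rewrite mulmxA -UC -mulmxA mulmxVp// mulmx1.
  by rewrite /W {1}UE [U1^t* *m _]mulmxA U11 mul1mx -UE.
clearbody W; have WW : W^t* *m W = 1%:M.
  rewrite -UU -[in RHS]UW adjmxM mulmxA -(mulmxA (W^t*)).
  by rewrite U11 mulmx1.
have WW' := mulmx1C WW.
exists (W *m M *m W^t*), (Y *m W^t*); split.
- by rewrite /orthonormal_cols adjmxM trmxCK mulmxA -(mulmxA W) YY mulmx1.
- by rewrite adjmxM trmxCK !mulmxA UW -(mulmxA _ _ W) WW mulmx1.
(* Also [U1 = U W^*]: both frames turn by the same unitary, which keeps the bound [e]. *)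
- have -> : Y *m W^t* - U1 = (Y - U) *m W^t*.
    by rewrite mulmxBl -[in RHS]UW -(mulmxA U1) WW' mulmx1.
  rewrite adjmxM trmxCK -[e]mul1r; apply: mx_boundM Ye.
  exact: mx_bound_isometry.
Qed.

(* With D = Y' - Y, the equation A X = F X reads
   M' Y^* X = U^* F X - M' D^* X, which bounds M' because Y^* X is bounded below,
   and then (M' - M) Y^* X = - M' D^* X bounds M' - M. *)
Lemma near_factor_dist (R : realType) (n s k : nat) (a b c f sigma : R)
    (A F : 'M[R[i]]_n) (X : 'M[R[i]]_(n, s)) (U Y : 'M[R[i]]_(n, k))
    (M : 'M[R[i]]_k) :
  orthonormal_cols U -> orthonormal_cols X -> orthonormal_cols Y ->
  F = U *m M *m Y^t* -> mx_bound ((Y - U)^t*) b ->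
  near_factor U a A -> A *m X = F *m X -> mx_bound (F *m X) f ->
  0 < sigma -> (forall v : 'rV_k, sigma * vnorm v <= vnorm (v *m Y^t* *m X)) ->
  1 <= c -> 1 <= c * sigma -> c * (a + b) < 1 ->
  mx_bound (A - F) (2 * f * (c ^+ 2 * (a + b) / (1 - c * (a + b)))).
Proof.
move=> UU XX YY FE Yb [M' [Y' [YY' AE Ya]]] AXFX FXf s0 low c1 cs ceta.
have a0 := Ya.1; have b0 := Yb.1; have f0 := FXf.1.
set eta := a + b; have eta0 : 0 <= eta by rewrite addr_ge0.
have iso1 (p : nat) (B : 'M[R[i]]_(n, p)) : orthonormal_cols B ->
    mx_bound B 1 /\ mx_bound (B^t*) 1.
  move=> BB; have B1 : mx_bound (B^t*) 1.
    by apply: mx_bound_isometry; rewrite trmxCK.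
  by split=> //; rewrite -[B]trmxCK; apply: mx_bound_adj.
have De : mx_bound ((Y' - Y)^t*) eta.
  have -> : (Y' - Y)^t* = (Y' - U)^t* - (Y - U)^t*.
    by rewrite -adjmxB opprB addrA subrK.
  exact: mx_boundB.
have DXe : mx_bound ((Y' - Y)^t* *m X) eta.
  by rewrite -[eta]mulr1; apply: mx_boundM De _; have [] := iso1 _ _ XX.
have MY'X : M' *m Y'^t* *m X = U^t* *m (F *m X).
  by rewrite -AXFX AE !mulmxA UU mul1mx.
have MYX : M *m Y^t* *m X = U^t* *m (F *m X).
  by rewrite FE !mulmxA UU mul1mx.
have Cf : mx_bound (U^t* *m (F *m X)) f.
  by rewrite -[f]mul1r; apply: mx_boundM FXf; have [] := iso1 _ _ UU.
(* The error term [M' D^* X] costs at most [eta |v M'|], which is absorbed on the left. *)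
have sM' v : (sigma - eta) * vnorm (v *m M') <= f * vnorm v.
  rewrite mulrBl lerBlDr (le_trans (low _))//.
  have -> : v *m M' *m Y^t* *m X =
      v *m (U^t* *m (F *m X)) - v *m M' *m ((Y' - Y)^t* *m X).
    rewrite -MY'X adjmxB mulmxBl mulmxBr !mulmxA.
    by rewrite opprB addrC subrK.
  by rewrite (le_trans (ler_vnormB _ _))// lerD ?Cf.2 ?DXe.2.
have MM'YX : (M' - M) *m Y^t* *m X = - (M' *m ((Y' - Y)^t* *m X)).
  rewrite mulmxBl mulmxBl MYX -MY'X adjmxB mulmxBl mulmxBr opprB.
  by rewrite !mulmxA.
have sMM' v : sigma * vnorm (v *m (M' - M)) <= eta * vnorm (v *m M').
  rewrite (le_trans (low _))// -(mulmxA v) -mulmxA MM'YX mulmxN vnormN mulmxA.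
  exact: DXe.2.
have c0 : 0 < c by apply: lt_le_trans c1.
have M'b v : (1 - c * eta) * vnorm (v *m M') <= c * f * vnorm v.
  (* [1 <= c * sigma] trades [sigma] for the denominator of the final bound. *)
  have le0 : 1 - c * eta <= c * (sigma - eta) by rewrite mulrBr lerD2r.
  rewrite (le_trans (ler_wpM2r (vnorm_ge0 _) le0))// -!mulrA.
  by rewrite ler_wpM2l// ltW.
have MM'b v : vnorm (v *m (M' - M)) <= c * eta * vnorm (v *m M').
  rewrite -mulrA; apply: le_trans (ler_wpM2l (ltW c0) (sMM' v)).
  by rewrite mulrA ler_peMl ?vnorm_ge0.
have gt0 : 0 < 1 - c * eta by rewrite subr_gt0.
split=> [|v].
  by rewrite !mulr_ge0// ?invr_ge0 ?ltW// exprn_ge0// ltW.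
(* Telescoping: one error from the right frame, one from the middle factor. *)
have -> : A - F = U *m (M' *m (Y' - Y)^t* + (M' - M) *m Y^t*).
  by rewrite AE FE adjmxB mulmxBl mulmxBr addrA subrK mulmxBr !mulmxA.
have [_ U1] := (iso1 _ _ UU).1; have [_ Y1] := (iso1 _ _ YY).2.
set u := v *m U; have uv : vnorm u <= vnorm v by have := U1 v; rewrite mul1r.
rewrite mulmxA -/u mulmxDr !mulmxA.
apply: le_trans (ler_vnormD _ _) _.
have h1 := De.2 (u *m M').
have h2 : vnorm (u *m (M' - M) *m Y^t*) <= c * eta * vnorm (u *m M').
  by apply: le_trans (MM'b u); have := Y1 (u *m (M' - M)); rewrite mul1r.
(* [1 <= c] brings the frame error to the same size as the other one, whence the factor 2. *)
have h3 : eta * vnorm (u *m M') <= c * eta * vnorm (u *m M').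
  by rewrite ler_wpM2r ?vnorm_ge0// ler_peMl.
apply: le_trans (lerD (le_trans h1 h3) h2) _.
rewrite -(ler_pM2l gt0).
have -> : (1 - c * eta) * (2 * f * (c ^+ 2 * eta / (1 - c * eta)) * vnorm v) =
    2 * (c * eta) * (c * f * vnorm v).
  by field; rewrite gt_eqF.
have -> : (1 - c * eta) *
    (c * eta * vnorm (u *m M') + c * eta * vnorm (u *m M')) =
    2 * (c * eta) * ((1 - c * eta) * vnorm (u *m M')) by ring.
have ceta0 : 0 <= c * eta by rewrite mulr_ge0// ltW.
apply: ler_wpM2l; first by rewrite mulr_ge0.
by rewrite (le_trans (M'b u))// ler_wpM2l// mulr_ge0// ltW.
Qed.

(** * Constants and the diameter of [Omega] *)

Theorem theorem4 (R : realType) (n s k : nat) (delta epsilon : R)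
    (F : 'M[R[i]]_n) (X : 'M[R[i]]_(n, s))
    (U0 : 'M[R[i]]_(n, k)) (Sigma0 : 'M[R]_k) (V0 : 'M[R[i]]_(n, k)) :
  (0 < k)%N ->
  0 <= delta -> delta <= epsilon -> epsilon < 1 ->
  near_symmetric k delta F ->
  (k <= s)%N ->
  orthonormal_cols X ->
  \rank (F *m X) = k ->
  slim_svd F U0 Sigma0 V0 ->
  let c : R := sigma_max (X ^t* *m V0) / sigma_min (X ^t* *m V0) ^+ 2 in
  let eta : R := Num.sqrt (2 * epsilon) + Num.sqrt (2 * delta) in
  c * eta < 1 ->
  (ereal_sup [set (spectral_norm (A - B))%:E |
      A in Omega k F X epsilon & B in Omega k F X epsilon]
    <= (4 * spectral_norm (F *m X) * (c ^+ 2 * eta / (1 - c * eta)))%:E)%E.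
Proof.
move=> k0 _ _ _ symF _ XX rFX [UU0 VV0 _ _ FE0] c eta ceta.
have [U UU [M [Y [YY FE Yb]]]] := near_symmetric_factor symF.
have XV0E : (X^t* *m V0)^t* = V0^t* *m X by rewrite adjmxM trmxCK.
have XV0free : row_free (V0^t* *m X).
  apply: (@row_free_rankM _ _ _ _ (U0 *m map_mx (real_complex R) Sigma0)).
  by rewrite mulmxA -FE0.
have [|smin0 smin_max low] := @sigma_min_lower_bound _ _ _ (X^t* *m V0) k0.
  by move=> v /eqP; rewrite XV0E mulmx_free_eq0// => /eqP.
have smax1 : sigma_max (X^t* *m V0) <= 1.
  apply: spectral_norm_le; rewrite -[1]mulr1; apply: mx_boundM.
    by apply: mx_bound_isometry; rewrite trmxCK.
  by rewrite -[V0]trmxCK; apply/mx_bound_adj/mx_bound_isometry; rewrite trmxCK.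
(* The product is [sigma_max / sigma_min]; this is why [c] carries a square in its denominator. *)
have cs : 1 <= c * sigma_min (X^t* *m V0).
  rewrite /c expr2 invfM mulrA mulfVK ?gt_eqF//.
  by rewrite ler_pdivlMr// mul1r.
have c1 : 1 <= c.
  have c0 : 0 <= c.
    by rewrite divr_ge0 ?exprn_ge0// ltW// (lt_le_trans smin0).
  by rewrite (le_trans cs)// ler_piMr// (le_trans smin_max).
have M_unit : M \in unitmx.
  apply: (@unitmx_rankM _ _ _ _ U M (Y^t*)); rewrite -FE; exact: symF.1.
(* [Y] may come from another SVD than [V0]. As a left multiple of [F], [Y^*] has its rows in the row
   space of [V0^*], so [Y^* V0] is an isometry and the lower bound for [V0^* X] passes to
   [Y^* X]. *)
have YE : Y^t* = invmx M *m U^t* *m F.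
  by rewrite FE !mulmxA -(mulmxA _ _ U) UU mulmx1 mulVmx// mul1mx.
have YV0 : Y^t* *m V0 *m V0^t* = Y^t*.
  by rewrite YE FE0 !mulmxA -(mulmxA _ _ V0) VV0 mulmx1.
have YV0_iso : (Y^t* *m V0) *m (Y^t* *m V0)^t* = 1%:M.
  by rewrite adjmxM trmxCK mulmxA YV0.
have lowY v : sigma_min (X^t* *m V0) * vnorm v <= vnorm (v *m Y^t* *m X).
  have -> : vnorm v = vnorm (v *m (Y^t* *m V0)).
    apply: eq_vnorm; rewrite [in RHS]adjmxM mulmxA -(mulmxA v) YV0_iso.
    by rewrite mulmx1.
  by apply: le_trans (low _) _; rewrite XV0E -{2}YV0 !mulmxA lexx.
have dist A : Omega k F X epsilon A -> mx_bound (A - F)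
    (2 * spectral_norm (F *m X) * (c ^+ 2 * eta / (1 - c * eta))).
  move=> [symA AXFX]; have [UA UUA Afac] := near_symmetric_factor symA.
  apply: (near_factor_dist UU XX YY FE Yb _ AXFX _ smin0 lowY) => //.
    apply: (near_factor_transfer UUA UU _ AXFX rFX Afac).
    by rewrite FE -mulmxA.
  exact: mx_bound_spectral_norm.
apply: ge_ereal_sup => _ [A Aom [B Bom <-]]; rewrite lee_fin.
apply: spectral_norm_le.
have -> : A - B = (A - F) - (B - F) by rewrite opprB addrA subrK.
apply: mx_bound_le (mx_boundB (dist A Aom) (dist B Bom)).
(* Each distance to [F] contributes a factor 2, which gives the 4. *)
by rewrite -!mulrA -mulrDl -natrD.
Qed.
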